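(* Let $\mathcal{D}$ be any set. Then $\mathcal{B}r(\mathcal{D})$, the free brace algebra generated by $\mathcal{D}$, endowed with the pre-Lie product $\langle -;-\rangle$ (its binary brace operation), is a free pre-Lie algebra.
   Context: $K$ is a field of characteristic zero; all vector spaces and algebras are over $K$. A (left) pre-Lie algebra is a vector space $A$ with a bilinear product $\circ$ such that $(x\circ y)\circ z-x\circ(y\circ z)=(y\circ x)\circ z-y\circ(x\circ z)$ for all $x,y,z\in A$. A pre-Lie algebra is free if it is isomorphic to the free pre-Lie algebra generated by some set (equivalently, by some vector space). Trees: $\mathcal{T}_P^{\mathcal{D}}$ is the set of planar rooted trees (finite, nonempty) whose vertices are decorated by elements of $\mathcal{D}$. For $d\in\mathcal{D}$ and $t_1,\ldots,t_n\in\mathcal{T}_P^{\mathcal{D}}$ ($n\ge 0$), $B_d(t_1\ldots t_n)$ is the planar rooted tree obtained by grafting $t_1,\ldots,t_n$, in this order from left to right, on a common root decorated by $d$; $B_d(1)$ is the one-vertex tree decorated by $d$. The free brace algebra $\mathcal{B}r(\mathcal{D})$ generated by $\mathcal{D}$ is realized as the vector space $K\mathcal{T}_P^{\mathcal{D}}$ with basis $\mathcal{T}_P^{\mathcal{D}}$, with brace operations $\langle t_1,\ldots,t_{n-1};t_n\rangle$ equal to the sum of all planar graftings of the ordered forest $t_1\ldots t_{n-1}$ over $t_n$. Its binary operation $\langle -;-\rangle$ is a pre-Lie product, determined bilinearly and inductively by: $\langle t;B_d(1)\rangle=B_d(t)$ and $$\langle t;B_d(t_1\ldots t_n)\rangle=\sum_{i=0}^n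 B_d(t_1\ldots t_i\,t\,t_{i+1}\ldots t_n)+\sum_{i=1}^n B_d(t_1\ldots t_{i-1}\langle t;t_i\rangle t_{i+1}\ldots t_n)$$ for $t,t_1,\ldots,t_n\in\mathcal{T}_P^{\mathcal{D}}$, $d\in\mathcal{D}$. *)

(* Defs.v *)
From HB Require Import structures.
From mathcomp Require Import all_boot all_algebra finmap sesquilinear.
From mathcomp Require Import boolp monalg.

Set Implicit Arguments.
Unset Strict Implicit.
Unset Printing Implicit Defensive.

Import GRing.Theory.
Local Open Scope ring_scope.

Section PreLie.
Variable K : fieldType.

Definition is_preLie (A : lmodType K) (op : A -> A -> A) : Prop :=
  bilinear_for *:%R *:%R op /\
  forall x y z : A,
    op (op x y) z - op x (op y z) = op (op y x) z - op y (op x z).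

(* The universal property: [A], with product [op], is the free pre-Lie algebra
   generated by the set [X], embedded through [iota]. *)
Definition is_free_preLie_on (X : Type) (A : lmodType K) (op : A -> A -> A)
    (iota : X -> A) : Prop :=
  is_preLie op /\
  forall (B : lmodType K) (opB : B -> B -> B) (f : X -> B), is_preLie opB ->
  exists phi : {linear A -> B},
    [/\ {morph phi : x y / op x y >-> opB x y},
        forall a, phi (iota a) = f a
      & forall psi : {linear A -> B},
          {morph psi : x y / op x y >-> opB x y} ->
          (forall a, psi (iota a) = f a) -> psi =1 phi].

Definition is_free_preLie (A : lmodType K) (op : A -> A -> A) : Prop :=
  exists (X : Type) (iota : X -> A), is_free_preLie_on op iota.

End PreLie.

(* [PNode d [:: t1; ...; tn]] is B_d(t1 ... tn); the order of the list is the
   left-to-right order of the planar embedding. *)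
Inductive ptree (D : Type) : Type := PNode of D & seq (ptree D).

(* [D] is an arbitrary set, so the choice structure needed to form the space
   of finitely supported functions on trees comes from the axiom of choice. *)
HB.instance Definition _ (D : Type) := gen_eqMixin (ptree D).
HB.instance Definition _ (D : Type) := gen_choiceMixin (ptree D).

Section Brace.
Variables (K : fieldType) (D : Type).

(* The space with basis the planar decorated trees; the basis element of a
   tree [t] is [<< t >>]. *)
Definition Br : lmodType K := {malg K[ptree D]}.

Definition lin_ext (g : ptree D -> Br) (x : Br) : Br :=
  \sum_(u <- msupp x) x@_u *: g u.

(* <t; B_d(t1 ... tn)> for trees t, t1, ..., tn, with positions counted from
   0; in the second sum B_d is extended linearly in the i-th subtree. *)
Fixpoint brace_tree (t s : ptree D) : Br :=
  let: PNode d ts := s in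
    \sum_(i < (size ts).+1) << PNode d (take i ts ++ t :: drop i ts) >>
  + \sum_(i < size ts)
      lin_ext (fun u => << PNode d (take i ts ++ u :: drop i.+1 ts) >>)
              (nth 0 [seq brace_tree t u | u <- ts] i).

Definition brace (x y : Br) : Br :=
  \sum_(t <- msupp x) \sum_(s <- msupp y) (x@_t * y@_s) *: brace_tree t s.

End Brace.

(* Main.v *)
Require Import Defs.
From HB Require Import structures.
From mathcomp Require Import all_boot all_algebra finmap sesquilinear.
From mathcomp Require Import boolp classical_sets monalg.

Set Implicit Arguments.
Unset Strict Implicit.
Unset Printing Implicit Defensive.

Import GRing.Theory.
Local Open Scope ring_scope.

(** Write [A] for the space of planar trees and [a o x] for its brace product.
    The proof transports the following picture: if [A] is free on a subspace
    [V], then [A] is the module U(A) (x) V over the enveloping algebra of its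
    Lie algebra, and U(A) acts through the symmetric braces <b1 ... bk; y> that
    Guin and Oudom define in any pre-Lie algebra ([sbrace]).

    The product with a tree, a o B_d(t1 ... tn), is the sum of B_d over all
    insertions of [a] in the word t1 ... tn and all replacements of a letter ti
    by a o ti ([brace_node], with the operators [ins] and [der] on functions of
    words).  Given linear maps [h] and [q] from [A] to a pre-Lie algebra [B],
    cut the root of a tree after each of its children in turn and put
      e(B_d(t1 ... tn)) =
        sum over k of 1/k! <h t1 ... h tk; q(B_d(t(k+1) ... tn))>,
    which is [exp_decomp h q e].  Inserting or grafting [a] hits either the
    block before the cut or the one after it.  Before the cut, the k+1
    insertions of [h a] in a symmetric brace are equal, turn 1/(k+1)! into 1/k!
    (this is where characteristic zero enters), and together with the graftings
    they add up to [h a] acting on the left, by the very recursion that defines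
    symmetric braces.  After the cut one finds q(a o B_d(t(k+1) ... tn)).  So if
    [q] vanishes on A o A then e(a o x) = h(a) o e(x) ([exp_decomp_brace]).

    This is used three times.
    - For any linear [q], the relation with h = e defines [e] by recursion on
      trees; if [q] vanishes on A o A this [e] is a pre-Lie morphism
      ([exp_decomp_exists], [exp_decomp_morph]).
    - With B = A and h = e = id the relation is triangular in [q] and defines a
      map [p] from [A] to [A], with p(x) = x modulo A o A.  Comparing the
      decompositions of a o x and of [x] shows that [p] vanishes on A o A
      ([projection_brace]); so the image of [p] is a complement of A o A.
    - Applying a morphism [e] to the relation that defines [p] decomposes [e]
      with q = e p ([exp_decomp_comp]).  Hence a morphism is determined by its
      values on the image of [p] ([exp_decomp_unique]), and the morphism built
      from [q] takes the values of [q] there ([exp_decomp_inj]).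
    The free generators are then the p(t), for [t] in a maximal set of trees
    with linearly independent images under [p] ([maximal_free]). *)

(** * Linear and multilinear functions *)

Section Linear.
Variable K : fieldType.
Implicit Types U V W : lmodType K.

(** Most functions below are only known to satisfy [linear]; this gives access
    to the rewriting rules of bundled linear maps. *)
Lemma linear_pack U V (f : U -> V) :
  linear f -> exists g : {linear U -> V}, g = f :> (U -> V).
Proof.
move=> lf.
pose m := GRing.isLinear.Build K U V *:%R f lf.
pose g : {linear U -> V} := HB.pack f m.
by exists g.
Qed.

Lemma linear_add U V (f g : U -> V) :
  linear f -> linear g -> linear (fun x => f x + g x).
Proof. by move=> lf lg a u v /=; rewrite lf lg scalerDr addrACA. Qed.

Lemma linear_opp U V (f : U -> V) : linear f -> linear (fun x => - f x).
Proof. by move=> lf a u v /=; rewrite lf opprD scalerN. Qed.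

Lemma linear_scale U V k (f : U -> V) : linear f -> linear (fun x => k *: f x).
Proof. by move=> lf a u v /=; rewrite lf scalerDr !scalerA mulrC. Qed.

Lemma linear_cst0 U V : linear (fun _ : U => 0 : V).
Proof. by move=> a u v; rewrite scaler0 addr0. Qed.

Lemma linear_comp U V W (f : V -> W) (g : U -> V) :
  linear f -> linear g -> linear (fun x => f (g x)).
Proof. by move=> lf lg a u v /=; rewrite lg lf. Qed.

(** Functions of words stand for linear functions on the tensor algebra. *)
Definition multilinear U V (G : seq U -> V) :=
  forall l1 l2, linear (fun x => G (l1 ++ x :: l2)).

Lemma multilinear_cons U V (G : seq U -> V) c :
  multilinear G -> multilinear (fun s => G (c :: s)).
Proof. by move=> mG l1 l2; exact: (mG (c :: l1) l2). Qed.

End Linear.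

(** * Inserting and grafting in a word *)

Section InsDer.
Variables (A : Type) (op : A -> A -> A).

(** The transpose of the shuffle of a word with the letter [a].  Carrying the
    prefix of the word inside [G] keeps the recursion structural, here and in
    [der]. *)
Fixpoint ins (V : nmodType) (a : A) (G : seq A -> V) (l : seq A) : V :=
  if l is c :: l' then G [:: a, c & l'] + ins a (fun s => G (c :: s)) l'
  else G [:: a].

(** The transpose of the derivation of the tensor algebra extending [op a]. *)
Fixpoint der (V : nmodType) (a : A) (G : seq A -> V) (l : seq A) : V :=
  if l is c :: l' then G (op a c :: l') + der a (fun s => G (c :: s)) l'
  else 0.

Variable V : nmodType.
Implicit Types (G : seq A -> V) (a b c : A) (l s : seq A).

Lemma eq_ins a G G' l :
  (forall s, size s = (size l).+1 -> G s = G' s) -> ins a G l = ins a G' l.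
Proof.
elim: l G G' => [|c l IH] G G' eG /=; first exact: eG.
by congr (_ + _); [exact: eG | apply: IH => s Es; apply: eG; rewrite /= Es].
Qed.

Lemma eq_der a G G' l :
  (forall s, size s = size l -> G s = G' s) -> der a G l = der a G' l.
Proof.
elim: l G G' => [|c l IH] G G' eG //=.
by congr (_ + _); [exact: eG | apply: IH => s Es; apply: eG; rewrite /= Es].
Qed.

Lemma insD a G G' l :
  ins a (fun s => G s + G' s) l = ins a G l + ins a G' l.
Proof. by elim: l G G' => //= c l IH G G'; rewrite IH addrACA. Qed.

Lemma derD a G G' l :
  der a (fun s => G s + G' s) l = der a G l + der a G' l.
Proof.
by elim: l G G' => [|c l IH] G G' /=; rewrite ?addr0 // IH addrACA.
Qed.

Lemma ins_comm a b G l : ins b (ins a G) l = ins a (ins b G) l.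
Proof.
elim: l G => [|c l IH] G /=; first exact: addrC.
by rewrite !insD IH [LHS](AC ((1*2)*2) ((2*(1*4))*(3*5))).
Qed.

(** A letter replaced after the insertion is either an old one or the inserted
    [a], which becomes [op b a]. *)
Lemma ins_der a b G l :
  ins a (der b G) l = der b (ins a G) l + ins (op b a) G l.
Proof.
elim: l G => [|c l IH] G /=; first by rewrite addr0 add0r.
by rewrite insD derD IH [LHS](AC ((1*2)*(1*2)) (((2*4)*(3*5))*(1*6))).
Qed.

End InsDer.

Lemma ins_raddf (A : Type) (V W : nmodType) (f : {additive V -> W}) a
    (G : seq A -> V) l : ins a (fun s => f (G s)) l = f (ins a G l).
Proof. by elim: l G => //= c l IH G; rewrite IH raddfD. Qed.

Lemma der_raddf (A : Type) (op : A -> A -> A) (V W : nmodType)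
    (f : {additive V -> W}) a (G : seq A -> V) l :
  der op a (fun s => f (G s)) l = f (der op a G l).
Proof.
elim: l G => [|c l IH] G /=; first by rewrite raddf0.
by rewrite IH raddfD.
Qed.

Lemma ins_map (A B : Type) (h : A -> B) (V : nmodType) a (G : seq B -> V) l :
  ins a (fun s => G (map h s)) l = ins (h a) G (map h l).
Proof. by elim: l G => //= c l IH G; rewrite (IH (fun s => G (h c :: s))). Qed.

Lemma der_map (A B : eqType) opA opB (h : A -> B) (V : nmodType) a
    (G : seq B -> V) l :
  {in l, forall c, h (opA a c) = opB (h a) (h c)} ->
  der opA a (fun s => G (map h s)) l = der opB (h a) G (map h l).
Proof.
elim: l G => //= c l IH G hM; rewrite hM ?mem_head //.
by rewrite (IH (fun s => G (h c :: s))) // => x xl; apply/hM/mem_behead.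
Qed.

Section Multilinear.
Variables (K : fieldType) (A V : lmodType K) (op : A -> A -> A).
Hypothesis op_bilin : bilinear_for *:%R *:%R op.
Implicit Types (G : seq A -> V) (a b c : A) (l s : seq A).

Let opl c : linear (op^~ c) := op_bilin.1 c.
Let opr c : linear (op c) := op_bilin.2 c.

Lemma linear_ins_fun (U : lmodType K) a (F : U -> seq A -> V) l :
  (forall s, linear (F^~ s)) -> linear (fun x => ins a (F x) l).
Proof.
elim: l F => [|c l IH] F lF /=; first exact: lF.
by apply: linear_add; [exact: lF | apply: IH].
Qed.

Lemma linear_der_fun (U : lmodType K) a (F : U -> seq A -> V) l :
  (forall s, linear (F^~ s)) -> linear (fun x => der op a (F x) l).
Proof.
elim: l F => [|c l IH] F lF /=; first exact: linear_cst0.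
by apply: linear_add; [exact: lF | apply: IH].
Qed.

Lemma linear_ins G l : multilinear G -> linear (fun a => ins a G l).
Proof.
elim: l G => [|c l IH] G mG /=; first exact: (mG [::] [::]).
by apply: linear_add; [exact: (mG [::]) | apply/IH/multilinear_cons].
Qed.

Lemma linear_der G l : multilinear G -> linear (fun a => der op a G l).
Proof.
elim: l G => [|c l IH] G mG /=; first exact: linear_cst0.
apply: linear_add; last exact/IH/multilinear_cons.
exact: linear_comp (mG [::] l) (opl c).
Qed.

Lemma multilinear_ins a G : multilinear G -> multilinear (ins a G).
Proof.
move=> mG l1; elim: l1 G mG => [|c l1 IH] G mG l2 /=.
  apply: linear_add; first exact: (mG [:: a]).
  by apply: linear_ins_fun => s; exact: (mG [::]).
apply: linear_add; first exact: (mG [:: a, c & l1]).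
exact/(IH (fun s => G (c :: s)))/multilinear_cons.
Qed.

Lemma multilinear_der a G : multilinear G -> multilinear (der op a G).
Proof.
move=> mG l1; elim: l1 G mG => [|c l1 IH] G mG l2 /=.
  apply: linear_add; first exact: linear_comp (mG [::] l2) (opr a).
  by apply: linear_der_fun => s; exact: (mG [::]).
apply: linear_add; first exact: (mG (op a c :: l1)).
exact/(IH (fun s => G (c :: s)))/multilinear_cons.
Qed.

(** Replacements at distinct places commute; those at the same place differ
    by what the pre-Lie identity allows. *)
Lemma der_comm a b G l : multilinear G ->
  {in l, forall c,
    op (op a b) c + op b (op a c) = op (op b a) c + op a (op b c)} ->
  der op (op a b) G l + der op a (der op b G) l =
  der op (op b a) G l + der op b (der op a G) l.
Proof.
elim: l G => [|c l IH] G mG ac //=.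
have {}IH : _ = _ := IH _ (multilinear_cons c mG)
  (fun x xl => ac x (mem_behead (s := c :: l) xl)).
rewrite !derD.
rewrite [LHS](AC (2*(2*2)) ((1*3)*((4*5)*(2*6)))).
rewrite /= IH.
rewrite [RHS](AC (2*(2*2)) ((1*3)*((5*4)*(2*6)))). rewrite /=.
have [g eg] := linear_pack (mG [::] l : linear (fun x => G (x :: l))).
have {}eg x : G (x :: l) = g x by rewrite eg.
by congr (_ + _); rewrite !eg -!linearD ac ?mem_head.
Qed.

End Multilinear.

(** * Symmetric braces of a pre-Lie algebra *)

Section Symmetric.
Variables (A : Type) (V : nmodType).
Implicit Types (G : seq A -> V) (a b c : A) (l s : seq A).

Definition slot_sym G := forall l1 a b l2,
  G (l1 ++ [:: a, b & l2]) = G (l1 ++ [:: b, a & l2]).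

Lemma slot_sym_cons G c : slot_sym G -> slot_sym (fun s => G (c :: s)).
Proof. by move=> sG l1 a b l2; exact: (sG (c :: l1)). Qed.

Lemma slot_sym_der op a G : slot_sym G -> slot_sym (der op a G).
Proof.
move=> sG l1; elim: l1 G sG => [|e l1 IH] G sG b c l2 /=.
  rewrite addrCA (sG [::] _ c) (sG [::] b); do 2 congr (_ + _).
  by apply: eq_der => s _; exact: (sG [::]).
congr (_ + _); first exact: (sG (op a e :: l1)).
by apply: (IH (fun s => G (e :: s))); exact: slot_sym_cons.
Qed.

Lemma ins_sym a G l : slot_sym G -> ins a G l = G (a :: l) *+ (size l).+1.
Proof.
elim: l G => [|c l IH] G sG //=.
by rewrite IH ?(sG [::] c) ?mulrS //; exact: slot_sym_cons.
Qed.

End Symmetric.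

Lemma preLie_addE (K : fieldType) (A : lmodType K) (op : A -> A -> A) a b c :
  is_preLie op ->
  op (op a b) c + op b (op a c) = op (op b a) c + op a (op b c).
Proof.
move=> [_ /(_ a b c)/(canRL (subrK _)) ->].
by rewrite addrAC subrK.
Qed.

Section SymBrace.
Variables (K : fieldType) (B : lmodType K) (op : B -> B -> B).

(** The words in the correction term have the length of [l'] but other letters:
    hence the recursion on a bound [n] for the length.  The value 0 on longer
    words makes [sbrace_rec n] multilinear without restriction. *)
Fixpoint sbrace_rec n (l : seq B) (y : B) : B :=
  if l is b :: l' then
    if n is n'.+1 then
      op b (sbrace_rec n' l' y) - der op b (fun s => sbrace_rec n' s y) l'
    else 0
  else y.

Definition sbrace l y := sbrace_rec (size l) l y.

Lemma sbrace_cons b l y :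
  sbrace (b :: l) y = op b (sbrace l y) - der op b (sbrace^~ y) l.
Proof. by congr (_ - _); apply: eq_der => s es; rewrite /sbrace es. Qed.

Hypothesis preL : is_preLie op.
Let opl c : linear (op^~ c) := preL.1.1 c.
Let opr c : linear (op c) := preL.1.2 c.

Lemma multilinear_sbrace_rec n y : multilinear (fun l => sbrace_rec n l y).
Proof.
elim: n => [|n IH] [|c l1] l2 /=; try exact: linear_cst0.
  apply: linear_add; first exact: opl.
  exact/linear_opp/linear_der/IH/preL.1.
apply: linear_add; first exact: linear_comp (opr c) (IH l1 l2).
exact/linear_opp/(multilinear_der preL.1 c IH).
Qed.

Lemma multilinear_sbrace y : multilinear (sbrace^~ y).
Proof.
move=> l1 l2 a u v.
have sz x : size (l1 ++ x :: l2) = (size l1 + size l2).+1.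
  by rewrite size_cat addnS.
by rewrite /sbrace !sz multilinear_sbrace_rec.
Qed.

Lemma linear_sbrace l : linear (sbrace l).
Proof.
rewrite /sbrace; move: (size l) => n; elim: n l => [|n IH] [|b l] //=.
- exact: linear_cst0.
apply: linear_add; first exact: linear_comp (opr b) (IH l).
by apply/linear_opp/linear_der_fun => s; exact: IH.
Qed.

(** Expanding twice leaves three groups of terms: the associator of [a] and [b]
    applied to <l; y>, terms where one of [a], [b] acts outside and the other
    on [l], and terms where both act on [l].  Each is symmetric, the first by
    the pre-Lie identity and the last by [der_comm]. *)
Lemma sbrace_swap a b l y : sbrace [:: a, b & l] y = sbrace [:: b, a & l] y.
Proof.
have derS c d : der op c (fun s => sbrace (d :: s) y) l =
    op d (der op c (sbrace^~ y) l) - der op c (der op d (sbrace^~ y)) l.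
  have [f ef] := linear_pack (opr d).
  rewrite (@eq_der _ op _ c _ (fun s => f (sbrace s y) +
    - der op d (sbrace^~ y) s)); last by move=> s _; rewrite sbrace_cons ef.
  by rewrite derD (der_raddf op f) (der_raddf op -%R) /= ef.
have opB c u v : op c (u - v) = op c u - op c v.
  by have [f <-] := linear_pack (opr c); rewrite linearB.
rewrite !(sbrace_cons _ (_ :: l)) /= !derS !sbrace_cons !opB !opprD !opprK.
rewrite [LHS](AC (2*(2*2)) ((1*3)*((2*5)*(4*6)))).
rewrite [RHS](AC (2*(2*2)) ((1*3)*((5*2)*(4*6)))) /=.
rewrite (der_comm (multilinear_sbrace y)); last first.
  by move=> c _; exact: preLie_addE.
by congr (_ + _); rewrite -opprB preL.2 opprB.
Qed.

Lemma slot_sym_sbrace y : slot_sym (sbrace^~ y).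
Proof.
(* [slot_sym_der] needs a function symmetric on all words, while the induction
   only gives symmetry on shorter ones: hence the truncation at length N *)
suff sN N : slot_sym (fun s => if size s == N then sbrace s y else 0).
  move=> l1 a b l2; have := sN (size l1 + (size l2).+2)%N l1 a b l2.
  by rewrite !size_cat /= eqxx.
elim: N => [|N IH] l1 a b l2; rewrite !size_cat /=; first by rewrite !addnS.
case: eqP => // sz; case: l1 sz => [|c l1] sz /=; first exact: sbrace_swap.
move: sz; rewrite addSn => -[sz].
rewrite !sbrace_cons; congr (op c _ - _).
  by have := IH l1 a b l2; rewrite !size_cat /= sz eqxx.
pose G s := if size s == N then sbrace s y else 0.
have eG l : size l = N -> der op c (sbrace^~ y) l = der op c G l.
  by move=> sl; apply: eq_der => s es; rewrite /G es sl eqxx.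
by rewrite !eG ?size_cat //; apply: slot_sym_der.
Qed.

End SymBrace.

(** * Sums over the cuts of a word *)

Section Conv.
Variables (T V : Type) (W : nmodType) (Q : seq T -> V).

(** The convolution of [N] and [Q] for the deconcatenation coproduct. *)
Fixpoint conv (N : seq T -> V -> W) (l : seq T) : W :=
  N [::] (Q l) + if l is c :: l' then conv (fun s => N (c :: s)) l' else 0.

Lemma convD N N' l :
  conv (fun s y => N s y + N' s y) l = conv N l + conv N' l.
Proof.
elim: l N N' => [|c l IH] N N' /=; first by rewrite !addr0.
by rewrite IH addrACA.
Qed.

End Conv.

Lemma conv_map (T T' V : Type) (W : nmodType) (f : T -> T') (Q : seq T' -> V)
    (N : seq T' -> V -> W) l :
  conv (fun s => Q (map f s)) (fun s => N (map f s)) l = conv Q N (map f l).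
Proof. by elim: l N => //= c l IH N; rewrite (IH (fun s => N (f c :: s))). Qed.

Lemma conv_precomp (T V V' : Type) (W : nmodType) (g : V -> V')
    (Q : seq T -> V) (N : seq T -> V' -> W) l :
  conv Q (fun s y => N s (g y)) l = conv (fun s => g (Q s)) N l.
Proof. by elim: l N => //= c l IH N; rewrite (IH (fun s => N (c :: s))). Qed.

Lemma eq_conv_in (T : eqType) (V : Type) (W : nmodType) (Q : seq T -> V)
    (N N' : seq T -> V -> W) l :
  (forall s y, {subset s <= l} -> N s y = N' s y) -> conv Q N l = conv Q N' l.
Proof.
elim: l N N' => [|c l IH] N N' eN /=; first by rewrite eN.
congr (_ + _); first by rewrite eN.
apply: IH => s y sl; apply: eN => x; rewrite !inE => /predU1P[-> | /sl ->].
  by rewrite eqxx.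
by rewrite orbT.
Qed.

Lemma eq_convl (T V : Type) (W : nmodType) (Q Q' : seq T -> V)
    (N : seq T -> V -> W) l :
  (forall s, (size s <= size l)%N -> Q s = Q' s) -> conv Q N l = conv Q' N l.
Proof.
elim: l N => [|c l IH] N eQ /=; first by rewrite eQ.
by rewrite eQ // IH // => s sl; rewrite eQ //= ltnW.
Qed.

(** The factorization with empty l1 contributes [Q l] itself, and the others
    only involve [Q] on shorter words. *)
Lemma conv_inj (T : Type) (V : zmodType) (Q Q' : seq T -> V)
    (N : seq T -> V -> V) :
  (forall y, N [::] y = y) -> (forall l, conv Q N l = conv Q' N l) ->
  Q =1 Q'.
Proof.
move=> N1 eC l; have [n] := ubnP (size l).
elim: n l => // n IH l lt_n; have := eC l; case: l lt_n => [|c l] lt_n /=.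
  by rewrite !N1 !addr0.
rewrite !N1 (@eq_convl _ _ _ Q Q'); first exact: addIr.
by move=> s sl; apply: IH; apply: leq_ltn_trans sl _.
Qed.

(** The inverse of the triangular system of [conv_inj]. *)
Fixpoint deconv (T : Type) (V : zmodType) (N : seq T -> V -> V)
    (R : seq T -> V) (l : seq T) : V :=
  R l - if l is c :: l' then conv (deconv N R) (fun s => N (c :: s)) l' else 0.

Lemma deconvK (T : Type) (V : zmodType) (N : seq T -> V -> V) R l :
  (forall y, N [::] y = y) -> conv (deconv N R) N l = R l.
Proof. by move=> N1; case: l => [|c l]; rewrite /= N1 subrK. Qed.

Section ConvLinear.
Variables (K : fieldType) (T : Type) (V W : lmodType K).
Implicit Types (Q : seq T -> V) (N : seq T -> V -> W).

Lemma conv_linear (W' : lmodType K) (f : {linear W -> W'}) Q N l :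
  conv Q (fun s y => f (N s y)) l = f (conv Q N l).
Proof.
elim: l N => [|c l IH] N /=; first by rewrite !addr0.
by rewrite IH linearD.
Qed.

Lemma conv0 N l : (forall s, linear (N s)) -> conv (fun=> 0) N l = 0.
Proof.
elim: l N => [|c l IH] N lN /=; have [f ef] := linear_pack (lN [::]).
  by rewrite -ef linear0 addr0.
by rewrite -ef linear0 IH ?addr0.
Qed.

Lemma conv_addl Q Q' N l : (forall s, linear (N s)) ->
  conv (fun s => Q s + Q' s) N l = conv Q N l + conv Q' N l.
Proof.
elim: l N => [|c l IH] N lN /=; have [f ef] := linear_pack (lN [::]).
  by rewrite -ef linearD !addr0.
by rewrite -ef linearD IH // addrACA.
Qed.

End ConvLinear.

Section ConvInsDer.
Variables (K : fieldType) (A V W : lmodType K) (op : A -> A -> A).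
Implicit Types (Q : seq A -> V) (N : seq A -> V -> W).

(** An insertion at the cut itself counts once in either block, according to
    the side of the cut on which [a] lies. *)
Lemma conv_ins a Q N l : (forall s, linear (N s)) ->
  ins a (conv Q N) l =
  conv Q (fun s y => ins a (N^~ y) s) l + conv (ins a Q) N l.
Proof.
elim: l N => [|c l IH] N lN /=; first by rewrite !addr0 addrC.
rewrite insD IH // convD.
have [f ef] := linear_pack (lN [::]).
rewrite -ef (ins_raddf f) raddfD.
by rewrite [LHS](AC ((1*2)*(1*2)) ((2*(3*5))*((1*4)*6))).
Qed.

Lemma conv_der a Q N l : (forall s, linear (N s)) ->
  der op a (conv Q N) l =
  conv Q (fun s y => der op a (N^~ y) s) l + conv (der op a Q) N l.
Proof.
elim: l N => [|c l IH] N lN /=.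
  have [f <-] := linear_pack (lN [::]).
  by rewrite raddf0 !addr0.
rewrite derD IH // convD.
have [f ef] := linear_pack (lN [::]).
rewrite -ef (der_raddf op f) raddfD.
by rewrite [LHS](AC (2*(1*2)) ((2*4)*((1*3)*5))) /= add0r.
Qed.

Lemma linear_conv_fun (U : lmodType K) Q (F : U -> seq A -> V -> W) l :
  (forall s y, linear (fun x => F x s y)) -> linear (fun x => conv Q (F x) l).
Proof.
elim: l F => [|c l IH] F lF /=.
  by apply: linear_add; [exact: lF | exact: linear_cst0].
apply: linear_add; first exact: (lF [::]).
exact: (IH (fun x s => F x (c :: s)) (fun s y => lF (c :: s) y)).
Qed.

Lemma multilinear_conv Q N : multilinear Q -> (forall s, linear (N s)) ->
  (forall y, multilinear (N^~ y)) -> multilinear (conv Q N).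
Proof.
move=> mQ lN mN l1; elim: l1 N lN mN => [|c l1 IH] N lN mN l2 /=.
  apply: linear_add; first exact: linear_comp (lN [::]) (mQ [::] l2).
  by apply: linear_conv_fun => s y; exact: (mN y [::] s).
apply: linear_add; first exact: linear_comp (lN [::]) (mQ (c :: l1) l2).
exact: (IH (fun s => N (c :: s)) (fun s => lN (c :: s))
             (fun y => multilinear_cons c (mN y)) l2).
Qed.

End ConvInsDer.

(** * The exponential weight *)

Section ExpBrace.
Variables (K : fieldType) (A B : lmodType K).
Variables (opA : A -> A -> A) (opB : B -> B -> B).
Hypotheses (charK : [pchar K] =i pred0) (preB : is_preLie opB).

Definition exp_sbrace (h : A -> B) (s : seq A) (y : B) : B :=
  (size s)`!%:R^-1 *: sbrace opB (map h s) y.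

Variable h : A -> B.

Lemma exp_sbrace0 y : exp_sbrace h [::] y = y.
Proof. by rewrite /exp_sbrace fact0 invr1 scale1r. Qed.

Lemma linear_exp_sbrace s : linear (exp_sbrace h s).
Proof. exact/linear_scale/linear_sbrace. Qed.

Lemma multilinear_exp_sbrace y : linear h -> multilinear (exp_sbrace h ^~ y).
Proof.
move=> lh l1 l2 a u v; rewrite /exp_sbrace !size_cat !map_cat /=.
exact: (linear_scale _
          (linear_comp (multilinear_sbrace preB y (map h l1) (map h l2)) lh)).
Qed.

(** All insertions contribute equally by symmetry of the braces, and the
    replacements cancel the correction term in the recursion of [sbrace]. *)
Lemma exp_sbrace_op a l y : {in l, forall c, h (opA a c) = opB (h a) (h c)} ->
  ins a (exp_sbrace h ^~ y) l + der opA a (exp_sbrace h ^~ y) l =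
  opB (h a) (exp_sbrace h l y).
Proof.
move=> hM; set G := fun s => sbrace opB s y.
have -> : ins a (exp_sbrace h ^~ y) l = (size l)`!%:R^-1 *: G (h a :: map h l).
  rewrite (@eq_ins _ _ _ _ (fun s =>
    (size l).+1`!%:R^-1 *: (G (map h s)))); last first.
    by move=> s es; rewrite /exp_sbrace es.
  rewrite (ins_raddf ( *:%R _)) /= (ins_map _ _ G).
  rewrite (ins_sym _ _ (slot_sym_sbrace preB y)) size_map.
  (* the k+1 equal insertions turn 1/(k+1)! into 1/k! *)
  rewrite -scaler_nat scalerA factS natrM invfM mulrC mulrA divff ?mul1r //.
  by rewrite ((pcharf0P K).1 charK).
have -> : der opA a (exp_sbrace h ^~ y) l =
    (size l)`!%:R^-1 *: der opB (h a) G (map h l).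
  rewrite (@eq_der _ _ _ _ _ (fun s => (size l)`!%:R^-1 *: (G (map h s)))).
    by rewrite (der_raddf _ ( *:%R _)) /= (der_map _ hM).
  by move=> s es; rewrite /exp_sbrace es.
have [f ef] := linear_pack (preB.1.2 (h a)).
by rewrite -scalerDr /G sbrace_cons subrK /exp_sbrace -ef linearZ.
Qed.

(** The computation on which the theorem rests: acting by [a] on a word that
    is cut in two blocks is acting by [h a] outside, plus acting by [a] on the
    second block. *)
Lemma conv_exp_sbrace_op a Q l :
  {in l, forall c, h (opA a c) = opB (h a) (h c)} ->
  ins a (conv Q (exp_sbrace h)) l + der opA a (conv Q (exp_sbrace h)) l =
  opB (h a) (conv Q (exp_sbrace h) l) +
  conv (fun s => ins a Q s + der opA a Q s) (exp_sbrace h) l.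
Proof.
move=> hM; have lE := linear_exp_sbrace.
rewrite conv_ins // conv_der // addrACA -convD; congr (_ + _).
  have [f ef] := linear_pack (preB.1.2 (h a)).
  rewrite -ef -(conv_linear f); apply: eq_conv_in => s y sl /=.
  by rewrite ef exp_sbrace_op // => c /sl; exact: hM.
by rewrite conv_addl.
Qed.

End ExpBrace.

(** * Linear and multilinear extension from a basis *)

Section LinearExtension.
Variables (K : fieldType) (T : choiceType).
Local Notation M := ({malg K[T]} : lmodType K).

Definition lext (V : lmodType K) (g : T -> V) (x : M) : V :=
  \sum_(t <- msupp x) x@_t *: g t.

Lemma lextEw (V : lmodType K) (g : T -> V) (x : M) (d : {fset T}) :
  (msupp x `<=` d)%fset -> lext g x = \sum_(t <- d) x@_t *: g t.
Proof.
move=> xd; rewrite /lext (big_fset_incl _ xd) // => t _ /mcoeff_outdom ->.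
by rewrite scale0r.
Qed.

Lemma linear_lext (V : lmodType K) (g : T -> V) : linear (lext g).
Proof.
move=> a x y; pose d := (msupp x `|` msupp y)%fset.
have xd : (msupp x `<=` d)%fset by exact: fsubsetUl.
have yd : (msupp y `<=` d)%fset by exact: fsubsetUr.
have zd : (msupp (a *: x + y) `<=` d)%fset.
  apply: fsubset_trans (msuppD_le _ _) _; rewrite fsubUset yd andbT.
  exact: fsubset_trans (msuppZ_le _ _) xd.
rewrite (lextEw _ xd) (lextEw _ yd) (lextEw _ zd) scaler_sumr -big_split /=.
by apply: eq_bigr => t _; rewrite mcoeffD mcoeffZ scalerDl scalerA.
Qed.

Lemma lextU (V : lmodType K) (g : T -> V) t : lext g << t >> = g t.
Proof.
by rewrite /lext msuppU oner_eq0 big_seq_fset1 mcoeffUU scale1r.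
Qed.

Lemma linear_lext_fun (U V : lmodType K) (F : U -> T -> V) x :
  (forall t, linear (F^~ t)) -> linear (fun v => lext (F v) x).
Proof.
move=> lF a v w; rewrite /lext scaler_sumr -big_split /=.
by apply: eq_bigr => t _; rewrite lF scalerDr !scalerA mulrC.
Qed.

Lemma lext_comp (V : lmodType K) (f : M -> V) x :
  linear f -> lext (fun t => f << t >>) x = f x.
Proof.
move=> lf; have [g <-] := linear_pack lf.
rewrite [in RHS](monalgE x) linear_sum; apply: eq_bigr => t _.
rewrite -linearZ; congr (g _); apply/malgP => s.
by rewrite mcoeffZ !mcoeffU mulr_natr.
Qed.

Lemma linear_ext (V : lmodType K) (f g : M -> V) : linear f -> linear g ->
  (forall t, f << t >> = g << t >>) -> f =1 g.
Proof.
move=> lf lg fg x; rewrite -(lext_comp x lf) -(lext_comp x lg).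
by apply: eq_bigr => t _; rewrite fg.
Qed.

Definition basis_seq : seq T -> seq M := map (fun t => << t >>).

Lemma multilinear_ext (V : lmodType K) (G G' : seq M -> V) :
  multilinear G -> multilinear G' ->
  (forall s, G (basis_seq s) = G' (basis_seq s)) -> G =1 G'.
Proof.
move=> mG mG' eG l; rewrite -[l]cat0s -[[::]]/(basis_seq [::]).
elim: l [::] => [|x l IH] s; first by rewrite cats0.
apply: (linear_ext (mG _ l) (mG' _ l)) => t.
by rewrite -cat_rcons -map_rcons IH.
Qed.

Fixpoint mlext (V : lmodType K) (G : seq T -> V) (l : seq M) : V :=
  if l is x :: l' then lext (fun t => mlext (fun s => G (t :: s)) l') x
  else G [::].

Lemma mlextU (V : lmodType K) (G : seq T -> V) s : mlext G (basis_seq s) = G s.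
Proof. by elim: s G => //= t s IH G; rewrite lextU IH. Qed.

Lemma multilinear_mlext (V : lmodType K) (G : seq T -> V) :
  multilinear (mlext G).
Proof.
move=> l1 l2; elim: l1 G => [|c l1 IH] G /=; first exact: linear_lext.
by apply: linear_lext_fun => t; exact: IH.
Qed.

End LinearExtension.

(** * The pre-Lie algebra of planar trees *)

Section BraceAlgebra.
Variables (K : fieldType) (D : Type).
Local Notation A := (Br K D).
Local Notation derb := (der (@brace K D)).
Implicit Types (t : ptree D) (d : D) (s : seq (ptree D)) (a b x y z : A).

(** The induction principle generated for [ptree] gives no hypothesis on the
    subtrees, which are nested in a sequence. *)
Lemma ptree_ind_in (P : ptree D -> Prop) :
  (forall d s, {in s, forall t, P t} -> P (PNode d s)) -> forall t, P t.
Proof.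
move=> PN; fix IH 1 => -[d s]; apply: PN.
elim: s => [u|t s IHs u]; first exact: (fun e => False_ind _ (notF e)).
rewrite inE => /predU1P[-> | us]; [exact: (IH t) | exact: (IHs u us)].
Qed.

Lemma braceE x y : brace x y = lext (fun t => lext (brace_tree K t) y) x.
Proof.
apply: eq_bigr => t _; rewrite scaler_sumr.
by apply: eq_bigr => s _; rewrite scalerA.
Qed.

Lemma brace_bilinear : bilinear_for *:%R *:%R (@brace K D).
Proof.
split=> [y | x] c u v; rewrite !braceE; first exact: linear_lext.
exact: (linear_lext_fun x (fun t => linear_lext (brace_tree K t))).
Qed.

Lemma braceU t u : brace << t >> << u >> = brace_tree K t u.
Proof. by rewrite braceE !lextU. Qed.

(** B_d on words of arbitrary elements of [A]: with it, grafting on a child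
    stays inside one word instead of expanding into a sum of trees. *)
Definition node d : seq A -> A := mlext (fun s => << PNode d s >>).

Lemma nodeU d s : node d (basis_seq K s) = << PNode d s >>.
Proof. exact: mlextU. Qed.

Lemma multilinear_node d : multilinear (node d).
Proof. exact: multilinear_mlext. Qed.

(** [ins_sum] and [der_sum] turn the two sums over positions that define
    [brace_tree] into the recursive operators. *)
Lemma ins_sum (V : nmodType) t (G : seq (ptree D) -> V) s :
  \sum_(i < (size s).+1) G (take i s ++ t :: drop i s) = ins t G s.
Proof.
elim: s G => [|c s IH] G /=; first by rewrite big_ord1.
by rewrite big_ord_recl /= -IH.
Qed.

Lemma der_sum (V : lmodType K) t (G : seq A -> V) s : multilinear G ->
  \sum_(i < size s)
     lext (fun u => G (basis_seq K (take i s ++ u :: drop i.+1 s)))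
          (nth 0 [seq brace_tree K t u | u <- s] i) =
  derb << t >> G (basis_seq K s).
Proof.
elim: s G => [|c s IH] G mG /=; first by rewrite big_ord0.
rewrite big_ord_recl /= -(IH _ (multilinear_cons _ mG)) drop0 braceU.
by congr (_ + _); apply: (lext_comp _ (mG [::] _)).
Qed.

Lemma brace_node a d l :
  brace a (node d l) = ins a (node d) l + derb a (node d) l.
Proof.
have mN := multilinear_node d.
move: a; apply: linear_ext.
- exact: brace_bilinear.1.
- apply: linear_add; first exact: linear_ins.
  exact: (linear_der brace_bilinear l mN).
move=> t; move: l; apply: multilinear_ext.
- by move=> l1 l2; exact: (linear_comp (brace_bilinear.2 _) (mN l1 l2)).
- move=> l1 l2; apply: linear_add; first exact: multilinear_ins.
  exact: (multilinear_der brace_bilinear _ mN l1 l2).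
move=> s; rewrite nodeU braceU -(ins_map (fun t => << t >>)) -ins_sum.
rewrite -der_sum //=; congr (_ + _); apply: eq_bigr => i _.
  by rewrite nodeU.
by apply: eq_bigr => u _; rewrite nodeU.
Qed.

(** By induction on the tree on the right.  By [brace_node] the products
    a o (b o z) and b o (a o z) expand into the same composites of [ins] and
    [der], up to order; [ins_der] and [der_comm] reorder them and leave exactly
    the operators at [brace a b] and [brace b a] of the pre-Lie identity.  The
    induction hypothesis on the children is what [der_comm] asks for. *)
Lemma brace_preLie : is_preLie (@brace K D).
Proof.
split=> [|a b z]; first exact: brace_bilinear.
suff: brace (brace a b) z + brace b (brace a z) =
      brace (brace b a) z + brace a (brace b z).
  move=> /(canRL (addrK _)) ->.
  by rewrite addrAC addrK.
have br2 (c e : A) : linear (fun z => brace c (brace e z) : A).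
  exact: linear_comp (brace_bilinear.2 c) (brace_bilinear.2 e).
move: z; apply: linear_ext.
1,2: by apply: linear_add => //; exact: brace_bilinear.2.
elim/ptree_ind_in => d s IH; rewrite -nodeU.
have {}IH : {in basis_seq K s, forall c,
    brace (brace a b) c + brace b (brace a c) =
    brace (brace b a) c + brace a (brace b c)}.
  by move=> _ /mapP[t ts ->]; exact: IH.
move: (basis_seq K s) IH => l IH.
have brace2 (c e : A) : brace c (brace e (node d l)) =
    ins e (ins c (node d)) l +
    (derb c (ins e (node d)) l + ins (brace c e) (node d) l) +
    (derb e (ins c (node d)) l + derb e (derb c (node d)) l).
  have [f ef] := linear_pack (brace_bilinear.2 c : linear (brace c : A -> A)).
  pose G (r : seq A) := ins c (node d) r + derb c (node d) r.
  have -> : brace c (brace e (node d l)) =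
      f (ins e (node d) l) + f (derb e (node d) l).
    by rewrite brace_node -linearD ef.
  rewrite -(ins_raddf f) -(der_raddf _ f) /= ef.
  rewrite (@eq_ins _ _ _ (fun r => brace c (node d r)) G); last first.
    by move=> *; exact: brace_node.
  rewrite (@eq_der _ _ _ _ (fun r => brace c (node d r)) G); last first.
    by move=> *; exact: brace_node.
  by rewrite insD derD ins_der.
rewrite !brace2 !brace_node ins_comm.
rewrite [LHS](AC (2*((1*2)*2)) ((3*(1*5))*((4*6)*(2*7)))).
rewrite [RHS](AC (2*((1*2)*2)) ((3*(5*1))*((6*4)*(2*7)))) /=.
by rewrite (der_comm (multilinear_node d) IH).
Qed.

End BraceAlgebra.

(** * Extracting a basis from a spanning family *)

Section MaximalFree.
Variables (K : fieldType) (T : choiceType) (V : lmodType K).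
Local Notation M := ({malg K[T]} : lmodType K).

Definition supported (S : T -> Prop) (z : M) := forall t, ~ S t -> z@_t = 0.

(** By Zorn's lemma; a linear relation only involves finitely many vectors, so
    it lies in one member of a chain. *)
Lemma maximal_free (p : T -> V) : exists S : T -> Prop,
  (forall z, supported S z -> lext p z = 0 -> z = 0) /\
  forall x : T, exists2 z, supported S z & lext p z = p x.
Proof.
pose free S := forall z, supported S z -> lext p z = 0 -> z = 0.
have [|S [freeS maxS]] := @Zorn_bigcup T free.
  move=> F Ffree Ftot z zF pz0.
  have cover (r : seq T) :
      (forall t, t \in r -> (\bigcup_(X in F) X)%classic t) ->
      r = [::] \/ exists2 X, F X & forall t, t \in r -> X t.
    elim: r => [|t r IH] rF; [by left | right].
    have [X FX Xt] := rF t (mem_head _ _).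
    have [u ur|-> | [Y FY Yr]] := IH; first by apply: rF; rewrite inE ur orbT.
      by exists X => // u; rewrite inE => /eqP ->.
    have [XY|YX] := Ftot X Y FX FY.
      by exists Y => // u; rewrite inE => /predU1P[->|/Yr//]; exact: XY.
    by exists X => // u; rewrite inE => /predU1P[->//|/Yr]; exact: YX.
  have [t zt|z0 | [X FX zX]] := cover (msupp z).
  - move: zt; rewrite -mcoeff_neq0 => zt.
    by apply: contrapT => /zF/eqP; exact/negP.
  - by rewrite (monalgE z) z0 big_nil.
  - apply: (Ffree X FX) => // t Xt; apply/eqP; rewrite mcoeff_eq0.
    by apply/negP => /zX.
exists S; split=> // x; have [Sx | Sx] := pselect (S x).
  exists << x >>; last exact: lextU.
  by move=> t St; rewrite mcoeffU; case: eqP St => [<- /(_ Sx)|].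
have /maxS nfree : (S `<` [set t | S t \/ t = x])%classic.
  by split=> [t|/(_ x)]; [left | move=> /(_ (or_intror erefl))].
have [z zS /not_implyP[pz0 z0]] : exists2 z,
    supported [set t | S t \/ t = x]%classic z & ~ (lext p z = 0 -> z = 0).
  apply: contrapT => nz; apply: nfree => z zS.
  by apply: contrapT => nz'; apply: nz; exists z.
have zx : z@_x != 0.
  apply/eqP => zx; apply: z0; apply: freeS pz0 => t St.
  have [->// | tx] := pselect (t = x).
  by apply: zS => -[].
have [f ef] := linear_pack (linear_lext p).
exists (<< x >> - (z@_x)^-1 *: z) => [t St|]; last first.
  by rewrite -ef linearB linearZ /= ef lextU pz0 scaler0 subr0.
rewrite mcoeffB mcoeffZ mcoeffU; have [<- | tx] := eqVneq x t.
  by rewrite mulVf // subrr.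
by rewrite (zS t) ?mulr0 ?subr0 // => -[//|xt]; rewrite xt eqxx in tx.
Qed.

End MaximalFree.

(** * Decompositions of linear maps along symmetric braces *)

Lemma sbrace_morph (K : fieldType) (A B : lmodType K) (opA : A -> A -> A)
    (opB : B -> B -> B) (h : {linear A -> B}) l y :
  {morph h : a b / opA a b >-> opB a b} ->
  h (sbrace opA l y) = sbrace opB (map h l) (h y).
Proof.
move=> hM; rewrite /sbrace size_map; move: (size l) => n.
elim: n l => [|n IH] [|b l] //=; first exact: linear0.
rewrite linearB hM IH -(der_raddf _ h); congr (_ - _).
rewrite -(der_map (opA := opA)); first by apply: eq_der => s _; exact: IH.
by move=> c _; exact: hM.
Qed.

Section ExpDecomposition.
Variables (K : fieldType) (D : Type) (B : lmodType K) (opB : B -> B -> B).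
Hypotheses (charK : [pchar K] =i pred0) (preB : is_preLie opB).
Local Notation A := (Br K D).
Implicit Types (h q e : {linear A -> B}) (d : D).

Definition exp_decomp h q e := forall d s,
  e << PNode d s >> =
  conv (fun r => q << PNode d r >>)
       (fun r => exp_sbrace opB h (basis_seq K r)) s.

Lemma exp_decomp_node h q e d l : exp_decomp h q e ->
  e (node d l) = conv (fun r => q (node d r)) (exp_sbrace opB h) l.
Proof.
move=> hqe; move: l; apply: multilinear_ext => [l1 l2||s].
- exact: (linear_comp (linearP e) (multilinear_node d l1 l2)).
- apply: multilinear_conv => [l1 l2|s|y].
  + exact: (linear_comp (linearP q) (multilinear_node d l1 l2)).
  + exact: linear_exp_sbrace.
  + exact/multilinear_exp_sbrace/linearP.
- by rewrite nodeU hqe -conv_map; apply: eq_convl => r _; rewrite nodeU.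
Qed.

(** The morphism hypothesis on [h] is asked only for the children [l], so that
    the lemma can be used inside an induction on trees. *)
Lemma exp_decomp_brace h q e a d l : exp_decomp h q e ->
  {in l, forall c, h (brace a c) = opB (h a) (h c)} ->
  e (brace a (node d l)) = opB (h a) (e (node d l)) +
    conv (fun r => q (brace a (node d r))) (exp_sbrace opB h) l.
Proof.
move=> hqe hM; rewrite brace_node linearD -(ins_raddf e) -(der_raddf _ e) /=.
pose E := conv (fun r => q (node d r)) (exp_sbrace opB h).
rewrite (@eq_ins _ _ _ _ E); last by move=> *; exact: exp_decomp_node.
rewrite (@eq_der _ _ _ _ _ E); last by move=> *; exact: exp_decomp_node.
rewrite conv_exp_sbrace_op // (exp_decomp_node _ _ hqe); congr (_ + _).
apply: eq_convl => r _.
by rewrite brace_node linearD -(ins_raddf q) -(der_raddf _ q).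
Qed.

Lemma exp_decomp_inj h q q' e :
  exp_decomp h q e -> exp_decomp h q' e -> q =1 q'.
Proof.
move=> hq hq'; apply: linear_ext => [||[d s]]; try exact: linearP.
move: s; apply: (conv_inj (N := fun r => exp_sbrace opB h (basis_seq K r))).
  by move=> y; exact: exp_sbrace0.
by move=> r; rewrite -hq -hq'.
Qed.

(** The relation gives [e] on a tree from its values on the children. *)
Lemma exp_decomp_unique q e e' :
  exp_decomp e q e -> exp_decomp e' q e' -> e =1 e'.
Proof.
move=> he he'; apply: linear_ext => [||]; try exact: linearP.
elim/ptree_ind_in => d s IH; rewrite he he'; apply: eq_conv_in => r y rs.
rewrite /exp_sbrace -!map_comp; congr (_ *: sbrace _ _ _).
by apply/eq_in_map => t /rs; exact: IH.
Qed.

Lemma exp_decomp_morph q e : (forall a x, q (brace a x) = 0) ->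
  exp_decomp e q e -> {morph e : x y / brace x y >-> opB x y}.
Proof.
move=> q0 he a; apply: linear_ext => [||t].
- exact: (linear_comp (linearP e) ((brace_bilinear K D).2 a)).
- exact: (linear_comp (preB.1.2 (e a)) (linearP e)).
elim/ptree_ind_in: t => d s IH; rewrite -nodeU.
rewrite (exp_decomp_brace _ he); last by move=> _ /mapP[t ts ->]; exact: IH.
rewrite (@eq_convl _ _ _ _ (fun=> 0)); last by move=> r _; exact: q0.
by rewrite conv0 ?addr0 // => r; exact: linear_exp_sbrace.
Qed.

(** The word that is cut lists each child with its value, since the values of
    the recursive calls are needed before the cut and the children after it. *)
Fixpoint exp_tree (q : A -> B) (t : ptree D) : B :=
  let: PNode d s := t in
  conv (fun r => q << PNode d (unzip1 r) >>)
    (fun r y => (size r)`!%:R^-1 *: sbrace opB (unzip2 r) y)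
    [seq (u, exp_tree q u) | u <- s].

Lemma exp_decomp_exists q : exists e : {linear A -> B}, exp_decomp e q e.
Proof.
have [e ee] := linear_pack (linear_lext (exp_tree q)).
exists e => d s; rewrite ee lextU /= -!conv_map.
rewrite -(@eq_convl _ _ _ (fun r => q << PNode d r >>)) => [|r _]; last first.
  by rewrite /unzip1 -map_comp map_id.
apply: eq_conv_in => r y _; rewrite /exp_sbrace !size_map.
congr (_ *: sbrace _ _ _); rewrite /unzip2 -!map_comp.
by apply: eq_map => u /=; rewrite lextU.
Qed.

End ExpDecomposition.

(** * The projection onto the generators *)

Section Projection.
Variables (K : fieldType) (D : Type).
Local Notation A := (Br K D).
Hypothesis charK : [pchar K] =i pred0.

(** The term k = 0 of the relation is p(B_d(t1 ... tn)), and the others involve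
    [p] on trees with fewer children at the root. *)
Lemma indecomposable_projection :
  exists p : {linear A -> A}, exp_decomp (@brace K D) idfun p idfun.
Proof.
pose N r := exp_sbrace (@brace K D) idfun (basis_seq K r).
pose R d s : A := << PNode d s >>.
pose pT t : A := let: PNode d s := t in deconv N (R d) s.
have [p ep] := linear_pack (linear_lext pT).
exists p => d s; have N1 y : N [::] y = y by exact: exp_sbrace0.
rewrite -[LHS](deconvK (R d) s N1).
by apply: eq_convl => r _; rewrite ep lextU.
Qed.

(** [exp_decomp_brace] with h = e = id reads a o x = a o x + r, where r is the
    decomposition with p(a o -) in place of [p].  So r = 0, and p(a o -) = 0
    because the system is triangular. *)
Lemma projection_brace (p : {linear A -> A}) a x :
  exp_decomp (@brace K D) idfun p idfun -> p (brace a x) = 0.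
Proof.
move=> hp; have pB := brace_preLie K D.
have [f ef] := linear_pack (pB.1.2 a : linear (brace a)).
have -> : p (brace a x) = (p \o f) x by rewrite /= ef.
move: x; apply: linear_ext => [||[d s]].
1,2: exact: linearP || exact: linear_cst0.
pose N r := exp_sbrace (@brace K D) idfun (basis_seq K r).
apply: (@conv_inj _ _ (fun r => (p \o f) << PNode d r >>) (fun=> 0) N) => [y|r].
  exact: exp_sbrace0.
rewrite conv0 => [|?]; last exact: linear_exp_sbrace.
have /= := exp_decomp_brace (a := a) (l := basis_seq K r) charK pB d hp.
move=> /(_ (fun _ _ => erefl)); rewrite -[LHS]addr0 => /addrI ->.
by rewrite -conv_map; apply: eq_convl => r' _; rewrite nodeU /= ef.
Qed.

Lemma exp_decomp_comp (B : lmodType K) opB (p : {linear A -> A})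
    (h : {linear A -> B}) :
  {morph h : x y / brace x y >-> opB x y} ->
  exp_decomp (@brace K D) idfun p idfun -> exp_decomp opB h (h \o p) h.
Proof.
move=> hM hp d s; rewrite -[X in h X]/(idfun _) hp -conv_linear.
transitivity (conv (fun r => p << PNode d r >>)
    (fun r y => exp_sbrace opB h (basis_seq K r) (h y)) s).
  apply: eq_conv_in => r y _.
  by rewrite /exp_sbrace linearZ /= (sbrace_morph _ _ hM) map_id.
exact: (conv_precomp h).
Qed.

End Projection.

(** * Freeness *)

Theorem corollary11 (K : fieldType) (D : Type)
    (charK : [pchar K]%R =i pred0) :
  is_free_preLie (@brace K D).
Proof.
pose A := Br K D.
have [p hp] := indecomposable_projection K D.
have [S [freeS spanS]] := maximal_free (fun t => p << t >>).
have {freeS}freeS (z : A) : supported S z -> p z = 0 -> z = 0.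
  by move=> zS pz; apply: freeS => //; rewrite lext_comp //; exact: linearP.
have {spanS}/choice[c cP] x :
    exists z : {malg K[ptree D]}, supported S z /\ p z = p << x >>.
  have [z zS <-] := spanS x; exists z; split=> //.
  by rewrite lext_comp //; exact: linearP.
have [C eC] := linear_pack (linear_lext c).
have pC x : p (C x) = p x.
  move: x; apply: linear_ext => [||t].
  1,2: exact: (linearP (p \o C)) || exact: linearP.
  by rewrite eC lextU (cP t).2.
have CS x : supported S (C x).
  move=> s Ss; rewrite eC /lext raddf_sum big1 // => t _.
  by rewrite /= mcoeffZ (cP t).1 ?mulr0.
exists {t | S t}, (fun a => p << sval a >>); split; first exact: brace_preLie.
move=> B opB f preB.
(* [C x] is the combination of trees of [S] with the same image as [x] under
   [p]; prescribing values on [S] and composing with [C] gives a linear map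
   that vanishes on A o A, because [p] does *)
pose g t : B := if pselect (S t) is left St then f (exist _ t St) else 0.
have [G eG] := linear_pack (linear_lext g).
pose q : {linear A -> B} := G \o C.
have q0 a x : q (brace a x) = 0.
  by rewrite /q /= (freeS (C _)) ?linear0 // pC projection_brace.
have qS a : q << sval a >> = f a.
  case: a => t St; rewrite /q /=.
  have -> : C << t >> = << t >>.
    apply/eqP; rewrite -subr_eq0; apply/eqP; apply: freeS => [s Ss|].
      rewrite mcoeffB CS // mcoeffU; case: eqP => [ts|_]; last exact: subrr.
      by rewrite ts in St.
    by rewrite linearB pC subrr.
  rewrite eG lextU /g; case: pselect => // St'.
  by congr f; exact: eq_exist.
have [phi hphi] := exp_decomp_exists opB q.
have phiM := exp_decomp_morph charK preB q0 hphi.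
exists phi; split=> // [a | psi psiM psif].
  by rewrite -qS; exact: exp_decomp_inj (exp_decomp_comp phiM hp) hphi _.
have psip : psi \o p =1 q.
  move=> x; rewrite /= -pC /q /=; move: (C x) (CS x) => z zS.
  rewrite eG.
  transitivity (lext (fun t => psi (p << t >>)) z).
    by rewrite (lext_comp z (linearP (psi \o p))).
  apply: eq_bigr => t _ /=.
  have [St | St] := pselect (S t); last by rewrite zS // !scale0r.
  congr (_ *: _); rewrite /g; case: pselect => // St'.
  exact: psif (exist _ t St').
apply: exp_decomp_unique hphi => d s.
rewrite (exp_decomp_comp psiM hp); apply: eq_convl => r _; exact: psip.
Qed.
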